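(* Let $x,y$ be any elements with $x+y=u_3+u_4$ and $xy=u_1u_2$. Then for every $n\ge0$, $$P_n(u_1,u_2,u_3,u_4\mid\alpha,\beta)=\sum_{k=0}^n\binom nk A_k(x,y\mid0,\alpha+\beta)\bigl(\alpha x-\beta y+(\beta-\alpha)u_3\bigr)^{n-k}=\sum_{k=0}^n\binom nk A_k(x,y\mid\alpha+\beta,0)\bigl(\alpha y-\beta x+(\beta-\alpha)u_3\bigr)^{n-k}.$$
   Context: For $\sigma=\sigma_1\cdots\sigma_m\in\mathfrak S_m$: ${\rm asc}(\sigma)$, ${\rm des}(\sigma)$ are the numbers of $i\in[m-1]$ with $\sigma_i<\sigma_{i+1}$, resp. $\sigma_i>\sigma_{i+1}$; ${\rm LRmax}(\sigma)$ is the number of $i$ with $\sigma_j<\sigma_i$ for all $j<i$; ${\rm RLmax}(\sigma)$ is the number of $i$ with $\sigma_j<\sigma_i$ for all $j>i$. With the convention $\sigma_0=\sigma_{m+1}=0$: ${\rm W}(\sigma)$ is the number of $i\in[m]$ with $\sigma_{i-1}<\sigma_i>\sigma_{i+1}$; ${\rm V}(\sigma)$ is the number of $i$ with $1<i<m$ and $\sigma_{i-1}>\sigma_i<\sigma_{i+1}$; ${\rm rdd}(\sigma)$ is the number of $i$ with $1<i\le m$ and $\sigma_{i-1}>\sigma_i>\sigma_{i+1}$; ${\rm lda}(\sigma)$ is the number of $i$ with $1\le i<m$ and $\sigma_{i-1}<\sigma_i<\sigma_{i+1}$. Define $$P_n(u_1,u_2,u_3,u_4\mid\alpha,\beta)=\sum_{\sigma\in\mathfrak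 S_{n+1}}u_1^{{\rm V}(\sigma)}u_2^{{\rm W}(\sigma)-1}u_3^{{\rm rdd}(\sigma)}u_4^{{\rm lda}(\sigma)}\alpha^{{\rm LRmax}(\sigma)-1}\beta^{{\rm RLmax}(\sigma)-1},$$ and $A_n(x,y\mid\alpha,\beta)=\sum_{\sigma\in\mathfrak S_{n+1}}x^{{\rm asc}(\sigma)}y^{{\rm des}(\sigma)}\alpha^{{\rm LRmax}(\sigma)-1}\beta^{{\rm RLmax}(\sigma)-1}$ for $n\ge0$ (so $A_0=1$). *)

(* Defs.v *)
From mathcomp Require Import all_boot all_algebra all_fingroup.
Set Implicit Arguments. Unset Strict Implicit. Unset Printing Implicit Defensive.
Import GRing.Theory.
Local Open Scope ring_scope.

(* pv s i = sigma_i for 1 <= i <= m (values in 1..m), and 0 otherwise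
   (in particular sigma_0 = sigma_{m+1} = 0). Here sigma is a permutation
   s of 'I_m, with sigma_i := (s (i-1)) + 1. *)
Definition pv (m : nat) (s : 'S_m) (i : nat) : nat :=
  if i is i'.+1 then oapp (fun j : 'I_m => (s j).+1) 0%N (insub i') else 0%N.

Definition asc m (s : 'S_m) : nat :=
  count (fun i => pv s i < pv s i.+1)%N (iota 1 m.-1).
Definition des m (s : 'S_m) : nat :=
  count (fun i => pv s i.+1 < pv s i)%N (iota 1 m.-1).
Definition LRmax m (s : 'S_m) : nat :=
  count (fun i => all (fun j => pv s j < pv s i)%N (iota 1 i.-1)) (iota 1 m).
Definition RLmax m (s : 'S_m) : nat :=
  count (fun i => all (fun j => pv s j < pv s i)%N (iota i.+1 (m - i))) (iota 1 m).
Definition Wst m (s : 'S_m) : nat :=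
  count (fun i => (pv s i.-1 < pv s i) && (pv s i.+1 < pv s i))%N (iota 1 m).
Definition Vst m (s : 'S_m) : nat :=
  count (fun i => (pv s i < pv s i.-1) && (pv s i < pv s i.+1))%N (iota 2 (m - 2)).
Definition rdd m (s : 'S_m) : nat :=
  count (fun i => (pv s i < pv s i.-1) && (pv s i.+1 < pv s i))%N (iota 2 m.-1).
Definition lda m (s : 'S_m) : nat :=
  count (fun i => (pv s i.-1 < pv s i) && (pv s i < pv s i.+1))%N (iota 1 m.-1).

Definition Ppoly (R : comRingType) (n : nat) (u1 u2 u3 u4 a b : R) : R :=
  \sum_(s : 'S_n.+1)
    u1 ^+ Vst s * u2 ^+ (Wst s - 1) * u3 ^+ rdd s * u4 ^+ lda s
    * a ^+ (LRmax s - 1) * b ^+ (RLmax s - 1).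

Definition Apoly (R : comRingType) (n : nat) (x y a b : R) : R :=
  \sum_(s : 'S_n.+1)
    x ^+ asc s * y ^+ des s * a ^+ (LRmax s - 1) * b ^+ (RLmax s - 1).

(* Main.v *)
(** Inserting a new smallest letter into [sigma] at the front multiplies its
    weight by [a * u4], at the end by [b * u3], and in an inner gap creates a
    valley and changes only the type of the smaller neighbour. Writing
    [v = u1 * u2] (there is one more peak than valleys), this gives
    [P_(n+1) = (a * u4 + b * u3) * P_n + D P_n] for a derivation [D] with
    [D u3 = D u4 = v] and [D v = v * (u3 + u4)]. As [asc = V + lda] and
    [des = V + rdd], [A_n (x, y)] is the case [v = x * y], [u3 = y], [u4 = x].
    If [D x = D y = x * y], then [c = a * x - b * y + (b - a) * u3] satisfies
    [D c = 0] and [a * u4 + b * u3 = (a + b) * y + c], so that multiplication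
    by [c] commutes with [(a + b) * y + D] and the first identity is the
    binomial formula; the second one is obtained with [(a + b) * x]. Such a
    derivation exists on [R[t]] after the translations [x + t], [y + t],
    [u3 + t], [u4 + t]: it is [(x + t) * (y + t) * d/dt]. The theorem follows
    at [t = 0]. *)

Require Import Defs.
From mathcomp Require Import all_boot all_algebra all_fingroup.
From mathcomp Require Import zify ring.
Set Implicit Arguments. Unset Strict Implicit. Unset Printing Implicit Defensive.
Import GRing.Theory.
Local Open Scope ring_scope.


(** * Permutations as words of positive letters *)

Lemma iotaS m n : iota m.+1 n = map succn (iota m n).
Proof. exact: (iotaDl 1). Qed.

Lemma iota_last m n : iota m n.+1 = iota m n ++ [:: (m + n)%N].
Proof. by rewrite -addn1 iotaD. Qed.

Definition word m (s : 'S_m) : seq nat := [seq (s j : nat).+1 | j <- enum 'I_m].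

Lemma size_word m (s : 'S_m) : size (word s) = m.
Proof. by rewrite size_map size_enum_ord. Qed.

Lemma nth_word m (s : 'S_m) (j : 'I_m) : nth 0%N (word s) j = (s j).+1.
Proof. by rewrite (nth_map j) ?size_enum_ord // nth_ord_enum. Qed.

(** The head [0] is the convention for position 0; the default value of [nth] supplies the one for
    position [m + 1]. *)
Lemma pvE m (s : 'S_m) i : pv s i = nth 0%N (0%N :: word s) i.
Proof.
case: i => [|i] //=; case: insubP => [j _ <-|]; first by rewrite nth_word.
by rewrite -leqNgt => le_mi; rewrite nth_default ?size_word.
Qed.

Arguments pv : simpl never.

Lemma uniq_word m (s : 'S_m) : uniq (0%N :: word s).
Proof.
rewrite /= map_inj_uniq ?enum_uniq ?andbT; last by move=> i j [/val_inj/perm_inj].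
by apply/mapP => -[].
Qed.

Lemma word_gt0 m (s : 'S_m) : all (leq 1) (word s).
Proof. by rewrite all_map; apply/allP. Qed.

(** Turns the passage from ['S_m] to ['S_m.+1] into the insertion of a new smallest letter, the old
    letters being raised to make room. *)
Lemma word_lift_perm m (i : 'I_m.+1) (s : 'S_m) :
  let v := map succn (word s) in
  word (lift_perm i ord0 s) = take i v ++ 1%N :: drop i v.
Proof.
move=> v.
have sz_v : size v = m by rewrite size_map size_word.
have le_iv : (i <= size v)%N by rewrite sz_v -ltnS.
apply: (@eq_from_nth _ 0%N) => [|j].
  by rewrite size_word size_cat /= size_take_min size_drop sz_v; lia.
rewrite size_word => lt_j; rewrite -[j]/(val (Ordinal lt_j)) nth_word nth_cat.
rewrite size_takel //; case: (unliftP i (Ordinal lt_j)) => [k ->|->].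
  have vk : nth 0%N v k = (s k).+2 by rewrite (nth_map 0%N) ?size_word ?nth_word.
  rewrite lift_perm_lift /= /bump /=; have [le_ik | lt_ki] := leqP i k.
    by rewrite add1n ltnNge (leq_trans le_ik) //= subSn //= nth_drop subnKC // vk.
  by rewrite lt_ki nth_take // vk.
by rewrite lift_perm_id /= ltnn subnn.
Qed.

(** * Maxima from the right and from the left *)

Fixpoint rlmax (w : seq nat) : nat :=
  if w is x :: w' then (all (fun y => y < x)%N w' + rlmax w')%N else 0%N.

Lemma RLmax_word m (s : 'S_m) : RLmax s = rlmax (word s).
Proof.
pose N (w : seq nat) := count (fun i => all (fun y => y < nth 0%N w i)%N (drop i.+1 w))
             (iota 0 (size w)).
have NE (w : seq nat) : N w = rlmax w.
  elim: w => //= x w <-; rewrite /N /= drop0 iotaS.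
  by rewrite count_map.
rewrite -NE /N /RLmax size_word iotaS count_map.
apply: eq_in_count => i; rewrite mem_iota /= add0n => lt_im.
have -> : drop i.+1 (word s) = map (nth 0%N (word s)) (iota i.+1 (m - i.+1)).
  by rewrite map_nth_iota ?size_word ?subnKC // take_oversize // size_drop size_word.
rewrite iotaS !all_map.
apply: eq_all => j. by rewrite /= !pvE.
Qed.

(** Reversal lets one recursion serve both kinds of maxima; the induction therefore adds letters at
    the end of the word. *)
Lemma LRmax_word m (s : 'S_m) : LRmax s = rlmax (rev (word s)).
Proof.
pose N (w : seq nat) := count (fun i => all (fun y => y < nth 0%N w i)%N (take i w))
             (iota 0 (size w)).
have NE (w : seq nat) : N w = rlmax (rev w).
  elim/last_ind: w => // w x; rewrite rev_rcons /= => <-; rewrite /N size_rcons.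
  rewrite iota_last count_cat /= addn0 addnC add0n; congr (_ + _)%N.
    by rewrite nth_rcons ltnn eqxx -cats1 take_size_cat // all_rev.
  apply: eq_in_count => i; rewrite mem_iota /= add0n => lt_iw.
  by rewrite nth_rcons lt_iw -cats1 take_cat lt_iw.
rewrite -NE /N /LRmax size_word iotaS count_map.
apply: eq_in_count => i; rewrite mem_iota /= add0n => lt_im.
have -> : take i (word s) = map (nth 0%N (word s)) (iota 0 i).
  by rewrite map_nth_iota0 // size_word ltnW.
rewrite iotaS !all_map.
by apply: eq_all => j; rewrite /= !pvE.
Qed.

(** The [1] is hidden by any letter of [w2], and being smaller than all other letters it hides none
    of them. *)
Lemma rlmax_insert1 (w1 w2 : seq nat) :
  all (leq 2) (w1 ++ w2) -> w2 != [::] ->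
  rlmax (w1 ++ 1%N :: w2) = rlmax (w1 ++ w2).
Proof.
elim: w1 => [|x w1 IH] /=; first by case: w2 => [|[|[|y]] w2].
case/andP=> x_gt1 w_gt1 nz_w2; rewrite IH //; congr (_ + _)%N.
by rewrite !all_cat /= x_gt1.
Qed.

Lemma rlmax_rcons1 (w : seq nat) :
  all (leq 2) w -> rlmax (rcons w 1%N) = (rlmax w).+1.
Proof.
elim: w => //= x w IH /andP[x_gt1 w_gt1]; rewrite IH // all_rcons x_gt1 /=.
by rewrite addnS.
Qed.

Lemma rlmax_map (f : nat -> nat) (w : seq nat) :
  {mono f : m n / (m < n)%N} -> rlmax (map f w) = rlmax w.
Proof.
move=> f_mono; elim: w => //= x w ->; rewrite all_map; congr (_ + _)%N.
by rewrite (eq_all (a2 := fun y => (y < x)%N)) // => y; rewrite /= f_mono.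
Qed.

Lemma rlmax_gt0 (w : seq nat) : w != [::] -> (0 < rlmax w)%N.
Proof. by elim: w => //= x [|y w] //= IH _; rewrite addn_gt0 IH // orbT. Qed.

(** * Relations between ascents, descents, peaks and valleys *)

Section Counts.
Variables (m : nat) (s : 'S_m).
Let range := iota 1 m.

Lemma pv_neq i : (0 < i <= m)%N -> pv s i.-1 != pv s i.
Proof.
case: i => // i /= lt_im; rewrite !pvE nth_uniq ?uniq_word ?ltn_eqF //= size_word //.
by rewrite ltnS ltnW.
Qed.

Lemma pv_over : pv s m.+1 = 0%N.
Proof. by rewrite pvE nth_default //= size_word. Qed.

Lemma pv_gt0 i : (0 < i <= m)%N -> (0 < pv s i)%N.
Proof.
case: i => // i lt_im; rewrite pvE; apply: (allP (word_gt0 s)).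
by rewrite /= mem_nth ?size_word.
Qed.

Lemma pv_neqS i : (0 < i <= m)%N -> pv s i != pv s i.+1.
Proof.
move=> i_range; have := pv_gt0 i_range; case/andP: i_range => _.
rewrite leq_eqVlt => /orP[/eqP-> | lt_im _]; last exact: (@pv_neq i.+1).
by rewrite pv_over lt0n.
Qed.

(** No letter lies below a boundary zero, so the positions added here contribute nothing. The next
    lemmas bring the other statistics to the same range. *)
Lemma VstE : Vst s =
  count (fun i => (pv s i < pv s i.-1) && (pv s i < pv s i.+1))%N range.
Proof.
rewrite /Vst /range; case: m s pv_over => [|[|k]] s' ov //.
rewrite subSS subSS subn0 (iota_last 1 k.+1) count_cat /=.
by rewrite add1n ov ltn0 andbF !addn0.
Qed.

Lemma rddE : rdd s =
  count (fun i => (pv s i < pv s i.-1) && (pv s i.+1 < pv s i))%N range.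
Proof.
rewrite /rdd /range; case: m s pv_over => [|k] s' ov //=.
Qed.

Lemma ldaE : lda s =
  count (fun i => (pv s i.-1 < pv s i) && (pv s i < pv s i.+1))%N range.
Proof.
rewrite /lda /range; case: m s pv_over => [|k] s' ov //.
by rewrite (iota_last 1 k) count_cat /= !add1n ov ltn0 andbF !addn0.
Qed.

Lemma ascE : asc s = count (fun i => pv s i < pv s i.+1)%N range.
Proof.
rewrite /asc /range; case: m s pv_over => [|k] s' ov //.
by rewrite (iota_last 1 k) count_cat /= !add1n ov ltn0 !addn0.
Qed.

(** Each descent is now counted at its lower end, which is either a valley or a double descent. *)
Lemma desE : des s = count (fun i => pv s i < pv s i.-1)%N range.
Proof.
rewrite /des /range; case: m s pv_over => [|k] s' ov //=.
by rewrite (iotaS 1) count_map.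
Qed.

Lemma count_split (P Q S : pred nat) : {in range, forall i, P i = Q i + S i :> nat}%N ->
  (count P range = count Q range + count S range)%N.
Proof.
elim: range => //= i r IH eqP.
rewrite eqP ?mem_head // IH; first by rewrite addnACA.
by move=> j jr; rewrite eqP // inE jr orbT.
Qed.

Lemma asc_split : asc s = (Vst s + lda s)%N.
Proof.
rewrite ascE VstE ldaE; apply: count_split => i; rewrite mem_iota add1n ltnS.
by move/pv_neq; case: (ltngtP (pv s i) (pv s i.-1)); case: (pv s i < pv s i.+1)%N.
Qed.

Lemma des_split : des s = (Vst s + rdd s)%N.
Proof.
rewrite desE VstE rddE; apply: count_split => i; rewrite mem_iota add1n ltnS.
by move/pv_neqS; case: (ltngtP (pv s i) (pv s i.+1)); rewrite ?andbT ?andbF ?addn0.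
Qed.

End Counts.

(** Ascents counted at their upper ends, with the one from the initial zero, give
    [asc + 1 = W + lda]; counted at their lower ends, they give [asc = V + lda]. *)
Lemma Wst_split n (s : 'S_n.+1) : Wst s = (Vst s).+1.
Proof.
have ascW : (count (fun i => pv s i.-1 < pv s i)%N (iota 1 n.+1) = Wst s + lda s)%N.
  rewrite ldaE; apply: count_split => i; rewrite mem_iota add1n ltnS.
  by move/(pv_neqS s); case: (ltngtP (pv s i) (pv s i.+1)); rewrite ?andbT ?andbF ?addn0.
have : (count (fun i => pv s i.-1 < pv s i)%N (iota 1 n.+1) = (asc s).+1).
  rewrite /asc /= (iotaS 1) count_map.
  by have -> : (pv s 0 < pv s 1)%N by exact: pv_gt0.
by rewrite ascW asc_split; lia.
Qed.

(** * Weights of words, and insertion of the smallest letter as a derivation *)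

Section Weights.
Variables (S : comNzRingType) (v u3 u4 : S).

(* Contribution of the letter [b] between [a] and [c]; peaks weigh 1, since
   their number is determined by that of the valleys. *)
Definition triple_wt (a b c : nat) : S :=
  if (a < b)%N then (if (b < c)%N then u4 else 1)
  else (if (b < c)%N then v else u3).

(** [a] is the left neighbour of the first letter, and the last letter serves only as a right
    neighbour: words get closed by a [0]. *)
Fixpoint word_wt (a : nat) (w : seq nat) : S :=
  if w is b :: w' then
    if w' is c :: _ then triple_wt a b c * word_wt b w' else 1
  else 1.

Lemma word_wt_cons a b c w :
  word_wt a [:: b, c & w] = triple_wt a b c * word_wt b (c :: w).
Proof. by []. Qed.

Lemma word_wt_map (f : nat -> nat) a w :
  {mono f : m n / (m < n)%N} -> word_wt (f a) (map f w) = word_wt a w.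
Proof.
move=> f_mono; elim: w a => //= b [|c w] //= IH a.
by rewrite IH /triple_wt !f_mono.
Qed.

Lemma word_wt_head a a' b w :
  (a < b)%N = (a' < b)%N -> word_wt a (b :: w) = word_wt a' (b :: w).
Proof. by case: w => //= c w; rewrite /triple_wt => ->. Qed.

Lemma word_wt_prod a w :
  word_wt a w = \prod_(i <- iota 0 (size w).-1)
    triple_wt (nth 0%N (a :: w) i) (nth 0%N w i) (nth 0%N w i.+1).
Proof.
elim: w a => [|b [|c w] IH] a; rewrite ?big_nil // word_wt_cons IH.
have -> : iota 0 (size [:: b, c & w]).-1 = 0%N :: map succn (iota 0 (size (c :: w)).-1).
  by rewrite -iotaS.
by rewrite big_cons big_map.
Qed.

Lemma prod_count (T : Type) (r : seq T) (P : pred T) (z : S) :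
  z ^+ count P r = \prod_(i <- r) (if P i then z else 1).
Proof. by rewrite -big_mkcond big_const_seq iter_mulr_1. Qed.

Lemma word_wtE m (s : 'S_m) :
  v ^+ Vst s * u3 ^+ rdd s * u4 ^+ lda s = word_wt 0 (rcons (word s) 0%N).
Proof.
rewrite word_wt_prod size_rcons size_word VstE rddE ldaE !prod_count -!big_split.
rewrite (iotaS 0) big_map; apply: eq_big_seq => i; rewrite mem_iota add0n => lt_im.
have pvr j : (j <= m.+1)%N -> nth 0%N (0%N :: rcons (word s) 0%N) j = pv s j.
  rewrite pvE; case: j => //= j _; rewrite nth_rcons size_word.
  by case: ltngtP => // [lt_mj | ->]; rewrite nth_default ?size_word // ltnW.
rewrite -[nth _ (rcons _ _) i]/(nth 0%N (0%N :: rcons (word s) 0%N) i.+1).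
rewrite -[nth _ (rcons _ _) i.+1]/(nth 0%N (0%N :: rcons (word s) 0%N) i.+2).
rewrite !pvr ?ltnS //; [|by rewrite ltnW|by rewrite ltnW // ltnW].
have i1_range : (0 < i.+1 <= m)%N by [].
(* Neighbours differ, so each position has exactly one of the four types. *)
rewrite /triple_wt; have := pv_neq s i1_range; have := pv_neqS s i1_range.
by case: (ltngtP (pv s i) (pv s i.+1)) => // _;
  case: (ltngtP (pv s i.+1) (pv s i.+2)) => // _; rewrite /= ?(mulr1, mul1r).
Qed.

Hypotheses (D : S -> S) (DD : forall f g, D (f + g) = D f + D g).
Hypothesis (DM : forall f g, D (f * g) = D f * g + f * D g).
Hypotheses (D3 : D u3 = v) (D4 : D u4 = v) (Dv : D v = v * (u3 + u4)).

Lemma D_one : D 1 = 0.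
Proof.
by apply/(@addrI _ (D 1)); rewrite addr0; have := DM 1 1; rewrite !mulr1 mul1r => <-.
Qed.

Lemma D_zero : D 0 = 0.
Proof. by rewrite -(mulr0 0) DM !(mul0r, mulr0) addr0. Qed.

(* Inserting [1] into a gap changes only the type of the smaller neighbour and
   adds a valley, so grouping the gaps by that neighbour gives the product rule
   for [D]. The [if] term is the gap between [a] and [b]: it lies outside the
   range of the sum, but belongs to the group of [b] when [b < a]. *)
Lemma sum_insert_gaps a b w : uniq [:: a, b & w] -> (0 < b)%N -> all (leq 2) (b :: w) ->
  \sum_(i < size w) word_wt a (rcons (b :: take i w ++ 1%N :: drop i w) 0%N)
    + (if (b < a)%N then v * word_wt 1 (rcons (b :: w) 0%N) else 0)
  = D (word_wt a (rcons (b :: w) 0%N)).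
Proof.
(* One term for each neighbour larger than [y]: the new valley [1] takes that neighbour's place
   beside [y]. The three rules for [D] are exactly what this requires. *)
have D_triple x y z : (1 < y)%N -> (y != x)%N -> (y != z)%N ->
    D (triple_wt x y z) = (if (y < z)%N then v * triple_wt x y 1 else 0)
                        + (if (y < x)%N then v * triple_wt 1 y z else 0).
  move=> y_gt1 yx yz; rewrite /triple_wt y_gt1 [(y < 1)%N]ltnNge (ltnW y_gt1) /=.
  move: yx yz; case: (ltngtP y x) => // _ _; case: (ltngtP y z) => //= _ _;
    rewrite ?D_one ?D3 ?D4 ?Dv; ring.
elim: w a b => [|c w IH] a b /=.
  rewrite !inE => /andP[ab _] b_gt0 /andP[b_gt1 _].
  have [ba b0] : b != a /\ b != 0%N by rewrite -lt0n eq_sym.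
  by rewrite big_ord0 add0r !mulr1 D_triple // add0r.
move=> /and4P[]; rewrite !inE !negb_or => /and3P[ab ac aw] /andP[bc bw] cw uw.
move=> b_gt0 /and3P[b_gt1 c_gt1 w_gt1].
rewrite big_ord_recl /=.
have := IH b c; rewrite /= !inE negb_or bc bw cw uw c_gt1 w_gt1 (ltnW c_gt1) => /(_ isT isT isT) IHc.
rewrite DM D_triple //; last by rewrite eq_sym.
rewrite -IHc.
under eq_bigr => i _ do rewrite add0n /=.
rewrite -mulr_sumr.
set wb := match rcons w 0%N with [::] => 1 | x :: _ => triple_wt b c x * _ end.
set w1 := match rcons w 0%N with [::] => 1 | x :: _ => triple_wt 1 c x * _ end.
set gaps := \sum_(i < _) _.
have triple_b1c : triple_wt b 1 c = v by rewrite /triple_wt c_gt1 ltnNge (ltnW b_gt1).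
(* The gap between [b] and [c] comes from the derivative of the triple at [b] if [b < c], and from
   the extra term of the induction hypothesis if [c < b]. *)
rewrite triple_b1c; move: bc; case: (ltngtP b c) => // [lt_bc | lt_cb] _.
  have -> : wb = w1 by rewrite /wb /w1; case: (rcons w 0%N) => // x r; rewrite /triple_wt lt_bc c_gt1.
  by case: ifP => _; ring.
have -> : triple_wt a b c = triple_wt a b 1.
  by rewrite /triple_wt (ltnNge b c) (ltnNge b 1) (ltnW lt_cb) (ltnW b_gt1).
by case: ifP => _; ring.
Qed.

Lemma word_wt_rcons1 a b w : all (leq 2) (b :: w) ->
  word_wt a (rcons (rcons (b :: w) 1%N) 0%N) = u3 * word_wt a (rcons (b :: w) 0%N).
Proof.
elim: w a b => [|c w IH] a b /andP[b_gt1 w_gt1].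
  by rewrite /= /triple_wt !mulr1 mulrC ltn0 !(ltnNge b) (ltnW b_gt1).
rewrite ![rcons (b :: _) _]rcons_cons !rcons_cons !word_wt_cons.
by rewrite -!rcons_cons IH // mulrCA.
Qed.

Variables al be : S.
Hypotheses (Dal : D al = 0) (Dbe : D be = 0).

Definition full_wt (w : seq nat) : S :=
  word_wt 0 (rcons w 0%N) * al ^+ (rlmax (rev w) - 1) * be ^+ (rlmax w - 1).

Lemma D_constX c k : D c = 0 -> D (c ^+ k) = 0.
Proof.
by move=> Dc; elim: k => [|k IH]; rewrite ?expr0 ?D_one // exprS DM Dc IH mul0r mulr0 addr0.
Qed.

Lemma sum_insert (w : seq nat) : w != [::] -> uniq w -> all (leq 2) w ->
  \sum_(i < (size w).+1) full_wt (take i w ++ 1%N :: drop i w)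
  = (al * u4 + be * u3) * full_wt w + D (full_wt w).
Proof.
case: w => // b w _ uw w_gt1; have /andP[b_gt1 _] := w_gt1.
have b_gt0 := ltnW b_gt1.
have rev_gt1 : all (leq 2) (rev (b :: w)) by rewrite all_rev.
have rl_gt0 : (0 < rlmax (b :: w))%N by rewrite rlmax_gt0.
have lr_gt0 : (0 < rlmax (rev (b :: w)))%N.
  by rewrite rlmax_gt0 // -size_eq0 size_rev.
have expS (c : S) k : (0 < k)%N -> c ^+ k = c * c ^+ (k - 1).
  by case: k => // k _; rewrite subn1 exprS.
have front : full_wt (1%N :: b :: w) = al * u4 * full_wt (b :: w).
  rewrite /full_wt rev_cons rlmax_rcons1 // rcons_cons [rcons (b :: w) _]rcons_cons.
  rewrite word_wt_cons (@word_wt_head 1 0) ?b_gt1 //.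
  have -> : rlmax [:: 1%N, b & w] = rlmax (b :: w) by rewrite /= ltnNge b_gt0.
  rewrite /triple_wt b_gt1 subSS subn0 (expS al _ lr_gt0) /=.
  by ring.
have back : full_wt (rcons (b :: w) 1%N) = be * u3 * full_wt (b :: w).
  rewrite /full_wt rev_rcons rlmax_rcons1 // word_wt_rcons1 //.
  have -> : rlmax (1%N :: rev (b :: w)) = rlmax (rev (b :: w)).
    rewrite [LHS]/=; case: (rev _) lr_gt0 rev_gt1 => // c r _ /andP[c_gt1 _].
    by rewrite /= ltnNge (ltnW c_gt1).
  rewrite subSS subn0 (expS be _ rl_gt0).
  by ring.
(* Inner insertions keep both numbers of maxima, so the powers of [al] and [be] factor out as
   constants of [D]. With left neighbour [0] the extra term of [sum_insert_gaps] vanishes. *)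
have mid : \sum_(i < size w) full_wt (take i.+1 (b :: w) ++ 1%N :: drop i.+1 (b :: w))
           = D (full_wt (b :: w)).
  rewrite /full_wt !DM !D_constX // !mulr0 !addr0.
  rewrite -(@sum_insert_gaps 0 b w) ?ltn0 ?addr0 //; first last.
    by rewrite cons_uniq uw andbT; apply: contraL w_gt1 => w0; apply/allPn; exists 0%N.
  rewrite !mulr_suml; apply: eq_bigr => i _.
  rewrite [LHS](_ : _ = full_wt ((b :: take i w) ++ 1%N :: drop i w)) // /full_wt.
  have w_split : (b :: take i w) ++ drop i w = b :: w by rewrite /= cat_take_drop.
  have drop_nz : drop i w != [::] by rewrite -size_eq0 size_drop subn_eq0 -ltnNge ltn_ord.
  have rev_nz : rev (b :: take i w) != [::] by rewrite -size_eq0 size_rev.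
  by rewrite rev_cat rev_cons cat_rcons !rlmax_insert1 -?rev_cat ?w_split.
rewrite -(big_mkord xpredT (fun i => full_wt (take i _ ++ 1%N :: drop i _))).
rewrite big_nat_recr // big_nat_recl // big_mkord take0 drop0 cat0s mid front.
rewrite take_size drop_size cats1 back.
by rewrite -[LHS]/(al * u4 * _ + D _ + be * u3 * _); ring.
Qed.

Lemma full_wt_succ (w : seq nat) : all (leq 1) w -> full_wt (map succn w) = full_wt w.
Proof.
(* [f] agrees with [succn] on positive letters but fixes the boundary zeros. *)
move=> w_gt0; pose f k := if k is k'.+1 then k'.+2 else 0%N.
have f_mono : {mono f : m n / (m < n)%N} by move=> [|m] [|n].
have -> : map succn w = map f w.
  by apply/eq_in_map => -[|x] // /(allP w_gt0).
rewrite /full_wt -map_rev !rlmax_map // -[X in rcons _ X]/(f 0%N) -map_rcons.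
by rewrite -[X in word_wt X]/(f 0%N) word_wt_map.
Qed.

(** * The recurrence in [n] *)

Lemma sum_lift_perm n (F : 'S_n.+1 -> S) :
  \sum_(s : 'S_n.+1) F s = \sum_(s : 'S_n) \sum_(i < n.+1) F (lift_perm i ord0 s).
Proof.
rewrite pair_bigA (reindex (fun p => lift_perm p.2 ord0 p.1)) //=.
(* The position of the smallest letter and the pattern of the others determine the permutation;
   surjectivity follows by counting. *)
apply/onW_bij/inj_card_bij; last by rewrite card_prod !card_Sn card_ord factS mulnC.
move=> [s i] [s' i'] /= eq_ss'.
have eq_i : i = i'.
  by apply: (@perm_inj _ (lift_perm i ord0 s)); rewrite {2}eq_ss' !lift_perm_id.
rewrite -eq_i in eq_ss' *; congr (_, _); apply/permP => k.
by apply: (@lift_inj _ ord0); rewrite -!(lift_perm_lift i) eq_ss'.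
Qed.

Lemma Ppoly_full_wt n : Ppoly n v 1 u3 u4 al be = \sum_(s : 'S_n.+1) full_wt (word s).
Proof.
apply: eq_bigr => s _.
by rewrite expr1n mulr1 word_wtE /full_wt LRmax_word RLmax_word.
Qed.

Lemma Ppoly0 : Ppoly 0 v 1 u3 u4 al be = 1.
Proof.
have S1 (s : 'S_1) : s = 1%g by apply/permP => i; rewrite !ord1.
rewrite Ppoly_full_wt (big_pred1 1%g) => [|s]; last by rewrite (S1 s) /= eqxx.
have -> : word (1%g : 'S_1) = [:: 1%N].
  have := nth_word (1%g : 'S_1) ord0; have := size_word (1%g : 'S_1).
  by case: (word _) => [|k [|? ?]] //= _ ->; rewrite perm1.
by rewrite /full_wt /= /triple_wt !mulr1.
Qed.

Lemma Ppoly_rec n : Ppoly n.+1 v 1 u3 u4 al be =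
  (al * u4 + be * u3) * Ppoly n v 1 u3 u4 al be + D (Ppoly n v 1 u3 u4 al be).
Proof.
rewrite !Ppoly_full_wt sum_lift_perm (big_morph D DD D_zero) mulr_sumr -big_split /=.
(* Raising all letters of [word s] keeps its weight and frees the letter [1]. *)
apply: eq_bigr => s _; rewrite -(full_wt_succ (word_gt0 s)) -sum_insert.
- by rewrite size_map size_word; apply: eq_bigr => i _; rewrite word_lift_perm.
- by rewrite -size_eq0 size_map size_word.
- by rewrite map_inj_uniq; [case/andP: (uniq_word s) | exact: succn_inj].
by rewrite all_map; exact: word_gt0.
Qed.

End Weights.

(** * Reduction to one valley variable, and change of ring *)

Lemma Ppoly_mul_u1u2 (R : comNzRingType) n (u1 u2 u3 u4 a b : R) :
  Ppoly n u1 u2 u3 u4 a b = Ppoly n (u1 * u2) 1 u3 u4 a b.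
Proof.
by apply: eq_bigr => s _; rewrite Wst_split subn1 /= expr1n mulr1 exprMn.
Qed.

Lemma Apoly_Ppoly (R : comNzRingType) n (x y a b : R) :
  Apoly n x y a b = Ppoly n (x * y) 1 y x a b.
Proof.
apply: eq_bigr => s _; rewrite asc_split des_split expr1n mulr1 exprMn !exprD.
by ring.
Qed.

Lemma rmorph_Ppoly (R S : comNzRingType) (f : {rmorphism R -> S}) n u1 u2 u3 u4 a b :
  f (Ppoly n u1 u2 u3 u4 a b) = Ppoly n (f u1) (f u2) (f u3) (f u4) (f a) (f b).
Proof.
by rewrite rmorph_sum; apply: eq_bigr => s _; rewrite !rmorphM !rmorphXn.
Qed.

Lemma rmorph_Apoly (R S : comNzRingType) (f : {rmorphism R -> S}) n x y a b :
  f (Apoly n x y a b) = Apoly n (f x) (f y) (f a) (f b).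
Proof. by rewrite !Apoly_Ppoly rmorph_Ppoly rmorphM rmorph1. Qed.

(** * Binomial formula for a derivation plus a multiplication *)

Lemma sum_pascal (V : nmodType) (f : nat -> nat -> V) n :
  \sum_(k < n.+2) f k (n.+1 - k)%N *+ 'C(n.+1, k)
  = \sum_(k < n.+1) (f k.+1 (n - k)%N + f k (n - k).+1) *+ 'C(n, k).
Proof.
under [RHS]eq_bigr => k _ do rewrite mulrnDl.
rewrite big_split big_ord_recl /= bin0 subn0.
under eq_bigr => k _ do rewrite binS mulrnDr subSS.
rewrite big_split /= big_ord_recr /= bin_small // mulr0n addr0 addrA addrC.
congr (_ + _); rewrite big_ord_recl bin0 subn0; congr (_ + _).
by apply: eq_bigr => k _; rewrite subnSK.
Qed.

Section Binomial.
Variables (S : comNzRingType) (D : S -> S).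
Hypothesis DD : forall f g, D (f + g) = D f + D g.
Hypothesis DM : forall f g, D (f * g) = D f * g + f * D g.

(* The operators [t + D] and multiplication by [c] commute, so this is the
   binomial formula for [(t + c + D) ^ n] applied to [P 0]. *)
Lemma binomial_operator (A P : nat -> S) (t c : S) : D c = 0 -> P 0%N = A 0%N ->
  (forall n, A n.+1 = t * A n + D (A n)) ->
  (forall n, P n.+1 = (t + c) * P n + D (P n)) ->
  forall n, P n = \sum_(k < n.+1) 'C(n, k)%:R * A k * c ^+ (n - k).
Proof.
move=> Dc P0 AS PS; pose B n := \sum_(k < n.+1) A k * c ^+ (n - k) *+ 'C(n, k).
suff PB n : P n = B n.
  move=> n; rewrite PB; apply: eq_bigr => k _.
  by rewrite -mulrA mulr_natl.
elim: n => [|n IH]; first by rewrite P0 /B big_ord1 bin0 mulr1.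
have D0 := D_zero DM.
have DMn f k : D (f *+ k) = D f *+ k.
  by elim: k => [|k IHk]; rewrite ?mulr0n // !mulrS DD IHk.
(* As [D c = 0], applying [t + c + D] to [A k * c ^+ j] raises either [k] or [j] by one, which is
   the pattern of Pascal's rule. *)
rewrite PS IH /B (sum_pascal (fun k j => A k * c ^+ j)) (big_morph D DD D0).
rewrite mulr_sumr -big_split; apply: eq_bigr => k _ /=.
rewrite DMn DM (D_constX DM) // mulr0 addr0 mulrnAr -mulrnDl AS exprS.
by congr (_ *+ _); ring.
Qed.

Variables (x y u3 u4 a b : S).
Hypotheses (Dx : D x = x * y) (Dy : D y = x * y) (D3 : D u3 = x * y).
Hypotheses (hsum : x + y = u3 + u4) (Da : D a = 0) (Db : D b = 0).

Lemma Ppoly_binomial n :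
  Ppoly n (x * y) 1 u3 u4 a b
    = \sum_(k < n.+1) 'C(n, k)%:R * Apoly k x y 0 (a + b)
                       * (a * x - b * y + (b - a) * u3) ^+ (n - k)
  /\ Ppoly n (x * y) 1 u3 u4 a b
    = \sum_(k < n.+1) 'C(n, k)%:R * Apoly k x y (a + b) 0
                       * (a * y - b * x + (b - a) * u3) ^+ (n - k).
Proof.
have D0 := D_zero DM.
have DN f : D (- f) = - D f.
  by apply: (addrI (D f)); rewrite -DD !subrr D0.
have u4E : u4 = x + y - u3 by rewrite hsum addrC addKr.
have D4 : D u4 = x * y by rewrite u4E !DD DN Dx Dy D3 addrK.
have Dxy : D (x * y) = x * y * (u3 + u4) by rewrite DM Dx Dy -hsum; ring.
have Dxy' : D (x * y) = x * y * (y + x) by rewrite DM Dx Dy; ring.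
have Dab : D (a + b) = 0 by rewrite DD Da Db addr0.
have AS al be k : D al = 0 -> D be = 0 -> Apoly k.+1 x y al be =
    (al * x + be * y) * Apoly k x y al be + D (Apoly k x y al be).
  by move=> Dal Dbe; rewrite !Apoly_Ppoly (Ppoly_rec DD DM Dy Dx Dxy' Dal Dbe).
have PS := Ppoly_rec DD DM D3 D4 Dxy Da Db.
split.
- apply: (@binomial_operator (fun k => Apoly k x y 0 (a + b))
    (fun k => Ppoly k (x * y) 1 u3 u4 a b) ((a + b) * y)) => [||k|k].
  (* The coefficients [a], [-b], [b - a] are constants with sum 0, and [D] sends each of [x], [y],
     [u3] to [x * y]. *)
  + by rewrite !(DD, DN, DM) Da Db Dx Dy D3 ?D0; ring.
  + by rewrite Apoly_Ppoly !Ppoly0.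
  + by rewrite AS // mul0r add0r.
  by rewrite PS u4E; congr (_ * _ + _); ring.
apply: (@binomial_operator (fun k => Apoly k x y (a + b) 0)
  (fun k => Ppoly k (x * y) 1 u3 u4 a b) ((a + b) * x)) => [||k|k].
- by rewrite !(DD, DN, DM) Da Db Dx Dy D3 ?D0; ring.
- by rewrite Apoly_Ppoly !Ppoly0.
- by rewrite AS // mul0r addr0.
by rewrite PS u4E; congr (_ * _ + _); ring.
Qed.

End Binomial.

(** * The derivation on polynomials, and evaluation at 0 *)

Theorem theorem6p2 (R : comRingType) (u1 u2 u3 u4 a b x y : R)
    (hsum : x + y = u3 + u4) (hprod : x * y = u1 * u2) (n : nat) :
  Ppoly n u1 u2 u3 u4 a b
    = \sum_(k < n.+1) 'C(n, k)%:R * Apoly k x y 0 (a + b)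
                       * (a * x - b * y + (b - a) * u3) ^+ (n - k)
  /\ Ppoly n u1 u2 u3 u4 a b
    = \sum_(k < n.+1) 'C(n, k)%:R * Apoly k x y (a + b) 0
                       * (a * y - b * x + (b - a) * u3) ^+ (n - k).
Proof.
pose shift (c : R) : {poly R} := c%:P + 'X.
pose D (f : {poly R}) := shift x * shift y * f^`().
have DD f g : D (f + g) = D f + D g by rewrite /D derivD mulrDr.
have DM f g : D (f * g) = D f * g + f * D g by rewrite /D derivM; ring.
have Dshift c : D (shift c) = shift x * shift y.
  by rewrite /D derivD derivC derivX add0r mulr1.
have Dconst c : D c%:P = 0 by rewrite /D derivC mulr0.
(* Both sides gain twice the indeterminate, so this relation survives the translation. *)
have shift_sum : shift x + shift y = shift u3 + shift u4.
  by rewrite /shift addrACA -polyCD hsum polyCD addrACA.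
pose ev : {rmorphism {poly R} -> R} := horner_eval 0.
have evC c : ev c%:P = c by rewrite /= /horner_eval hornerC.
have ev_shift c : ev (shift c) = c by rewrite /= /horner_eval hornerD hornerC hornerX addr0.
have [E1 E2] := Ppoly_binomial DD DM (Dshift x) (Dshift y) (Dshift u3) shift_sum
  (Dconst a) (Dconst b) n.
(* Over polynomials the valley weight is [shift x * shift y]; only its value at 0, [x * y], has to
   be compared with [u1 * u2]. *)
rewrite Ppoly_mul_u1u2 -hprod; clearbody D ev shift.
by split; [move/(congr1 ev): E1 | move/(congr1 ev): E2];
  rewrite rmorph_Ppoly rmorphM rmorph1 !evC !ev_shift => ->; rewrite rmorph_sum;
  apply: eq_bigr => k _;
  rewrite !(rmorphM, rmorphXn, rmorphB, rmorphD, rmorph_nat) rmorph_Apoly;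
  rewrite !(rmorphD, rmorph0) !evC !ev_shift.
Qed.
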